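(* Let $\mathcal{G}$ be a family of connected graphs equipped with an isomorphism-invariant augmented labeling scheme $\Psi=\{\psi_G: G\in\mathcal{G}\}$. Suppose that $\Psi$ is locally injective, i.e. for every $G=(U,\alpha,\phi_G)\in\mathcal{G}$ and every $u\in U$ the restriction of $\psi_G$ to $N_G(u)$ is injective, and that $\Psi$ has magic symbols, i.e. for every $G=(U,\alpha,\phi_G)\in\mathcal{G}$ there is a vertex $u\in U$ with $|\psi_G^{-1}(\psi_G(u))|=1$. Then OGJ with cost $c_\Psi$ detects and identifies isomorphism for $\mathcal{G}$.
   Context: A weight function on a finite set $U$ is a map $\alpha:U\times U\to\mathbb{R}$ with $\alpha\ge 0$, $\alpha(u,u')=\alpha(u',u)$ and $\sum_{u,u'\in U}\alpha(u,u')=1$; its marginal is $p(u)=\sum_{u'}\alpha(u,u')$. A graph is a triple $G=(U,\alpha,\phi_G)$ with $U$ finite, $\alpha$ a weight function on $U$ and $\phi_G:U\to\mathcal{L}$ a (primary) label function; self-loops are allowed. $N_G(u)=\{u'\in U:\alpha(u,u')>0\}$. $G$ is connected if for all distinct $u,u'$ there are $u=u_0,\dots,u_n=u'$ with $\alpha(u_k,u_{k+1})>0$ for all $k$. Graphs $G=(U,\alpha,\phi_G)$, $H=(V,\beta,\phi_H)$ are isomorphic ($G\cong H$) if there is a bijection $f:U\to V$ with $\alpha(u,u')=\beta(f(u),f(u'))$ and $\phi_G(u)=\phi_H(f(u))$ for all $u,u'$. Weight joinings: if $\alpha$ on $U$ has marginal $p$ and $\beta$ on $V$ has marginal $q$,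 a weight joining is a weight function $\gamma$ on $U\times V$ whose marginal $r_\gamma(u,v)=\sum_{u',v'}\gamma((u,v),(u',v'))$ satisfies $\sum_v r_\gamma(u,v)=p(u)$, $\sum_u r_\gamma(u,v)=q(v)$, and for all $u,u'\in U$, $v,v'\in V$: $p(u)\sum_{\tilde v}\gamma((u,v),(u',\tilde v))=\alpha(u,u')r_\gamma(u,v)$ and $q(v)\sum_{\tilde u}\gamma((u,v),(\tilde u,v'))=\beta(v,v')r_\gamma(u,v)$. $\mathcal{J}(\alpha,\beta)$ is the set of weight joinings. A weight joining is bijective if for each $u$ there is a unique $v$ with $r_\gamma(u,v)>0$ and for each $v$ a unique $u$ with $r_\gamma(u,v)>0$. Augmented labeling scheme: for each $G\in\mathcal{G}$ a secondary label function $\phi'_G:U\to\mathcal{L}'$ is given and $\psi_G=(\phi_G,\phi'_G)$. $\Psi$ is isomorphism-invariant if $\psi_H\circ f=\psi_G$ for all $G,H\in\mathcal{G}$ and every isomorphism $f$ from $G$ to $H$. The cost is $c_\Psi(u,v)=1$ if $\psi_G(u)\ne\psi_H(v)$ and $0$ otherwise; $\rho_\Psi(G,H)=\min_{\gamma\in\mathcal{J}(\alpha,\beta)}\sum_{u,v}c_\Psi(u,v)r_\gamma(u,v)$, and $\mathcal{J}^*_\Psi(\alpha,\beta)$ is the set of minimizers. OGJ with cost $c_\Psi$ detects isomorphism for $\mathcal{G}$ if for all $G,H\in\mathcal{G}$: $\rho_\Psi(G,H)=0\iff G\cong H$. It identifies isomorphism for $\mathcal{G}$ if for every pair of isomorphic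 $G=(U,\alpha,\phi_G)$, $H=(V,\beta,\phi_H)$ in $\mathcal{G}$, the extreme points of $\mathcal{J}^*_\Psi(\alpha,\beta)$ are exactly the bijective weight joinings $\gamma\in\mathcal{J}(\alpha,\beta)$ with $\sum c_\Psi r_\gamma=0$. *)

(* Defs.v *)
From HB Require Import structures.
From mathcomp Require Import all_boot all_order all_algebra.
From mathcomp Require Import all_classical all_reals all_analysis.

Set Implicit Arguments.
Unset Strict Implicit.
Unset Printing Implicit Defensive.

Import Order.TTheory GRing.Theory Num.Theory.
Import numFieldNormedType.Exports.

Local Open Scope classical_set_scope.
Local Open Scope ring_scope.

Section Joinings.
Variable R : realType.

Definition is_weight (U : finType) (a : U -> U -> R) : Prop :=
  [/\ forall u u', 0 <= a u u',
      forall u u', a u u' = a u' u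
    & \sum_u \sum_u' a u u' = 1].

Definition marginal (U : finType) (a : U -> U -> R) (u : U) : R :=
  \sum_u' a u u'.

Definition joinings (U V : finType) (a : U -> U -> R) (b : V -> V -> R) :
    set (U * V -> U * V -> R) :=
  [set g | [/\ is_weight g,
    forall u, \sum_v marginal g (u, v) = marginal a u,
    forall v, \sum_u marginal g (u, v) = marginal b v,
    forall u u' v,
      marginal a u * (\sum_v' g (u, v) (u', v')) = a u u' * marginal g (u, v)
  & forall u v v',
      marginal b v * (\sum_u' g (u, v) (u', v')) = b v v' * marginal g (u, v)]].

Definition bijective_joining (U V : finType) (g : U * V -> U * V -> R) : Prop :=
  (forall u, exists! v, 0 < marginal g (u, v)) /\
  (forall v, exists! u, 0 < marginal g (u, v)).

Definition expected_cost (U V : finType) (c : U -> V -> R)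
    (g : U * V -> U * V -> R) : R :=
  \sum_u \sum_v c u v * marginal g (u, v).

(* The infimum is a minimum: see [ogj_distance_attained] below. *)
Definition ogj_distance (U V : finType) (a : U -> U -> R) (b : V -> V -> R)
    (c : U -> V -> R) : R :=
  inf [set expected_cost c g | g in joinings a b].

Definition optimal_joinings (U V : finType) (a : U -> U -> R)
    (b : V -> V -> R) (c : U -> V -> R) : set (U * V -> U * V -> R) :=
  [set g | joinings a b g /\
    forall g', joinings a b g' -> expected_cost c g <= expected_cost c g'].

Definition extreme_points (E : lmodType R) (A : set E) : set E :=
  [set x | A x /\ forall (y z : E) (t : R), A y -> A z -> 0 < t < 1 ->
    x = t *: y + (1 - t) *: z -> y = x /\ z = x].

End Joinings.

Section Attained.
Variables (R : realType) (U V : finType).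
Variables (a : U -> U -> R) (b : V -> V -> R) (c : U -> V -> R).

Lemma prod_joining : is_weight a -> is_weight b ->
  joinings a b (fun w w' => a w.1 w'.1 * b w.2 w'.2).
Proof.
move=> [a0 aC a1] [b0 bC b1].
have mE u v : marginal (fun w w' : U * V => a w.1 w'.1 * b w.2 w'.2) (u, v)
    = marginal a u * marginal b v.
  by rewrite /marginal big_distrlr /= pair_bigA.
split.
- split => [w w'|w w'|]; first exact: mulr_ge0.
    by rewrite aC bC.
  transitivity (\sum_u \sum_v marginal a u * marginal b v).
    rewrite [RHS]pair_bigA; apply: eq_bigr => w _.
    by rewrite -mE -surjective_pairing.
  by rewrite -big_distrlr /= a1 b1 mulr1.
- by move=> u; under eq_bigr do rewrite mE; rewrite -mulr_sumr b1 mulr1.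
- by move=> v; under eq_bigr do rewrite mE; rewrite -mulr_suml a1 mul1r.
- by move=> u u' v; rewrite mE /= -mulr_sumr mulrCA.
- by move=> u v v'; rewrite mE /= -mulr_suml mulrCA [RHS]mulrCA [b v v' * _]mulrC.
Qed.

Local Notation W := (U * V)%type.
Local Notation T := {ptws W -> {ptws W -> R^o}}.

Let continuous_coord (w w' : W) : continuous (fun g : T => g w w' : R^o).
Proof.
move=> g.
apply: (@continuous_comp T {ptws W -> R^o} R^o (proj w) (proj w')).
  exact: proj_continuous.
exact: proj_continuous.
Qed.

Let continuous_sum (I : finType) (F : I -> T -> R^o) :
  (forall i, continuous (F i)) -> continuous (fun g => \sum_i F i g : R^o).
Proof. by move=> cF; apply: continuous_big => // x; exact: add_continuous. Qed.

Let continuous_scale (k : R) (F : T -> R^o) :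
  continuous F -> continuous (fun g => k * F g : R^o).
Proof.
by move=> cF g; apply: continuousM; [exact: cst_continuous|exact: cF].
Qed.

Let continuous_marginal (w : W) :
  continuous (fun g : T => marginal g w : R^o).
Proof. exact: continuous_sum. Qed.

Let closed_eqf (F G : T -> R^o) :
  continuous F -> continuous G -> closed [set g | F g = G g].
Proof.
move=> cF cG.
have -> : [set g | F g = G g] = (fun g => F g - G g : R^o) @^-1` [set 0].
  by apply/seteqP; split=> g /= => [->|/subr0_eq//]; rewrite subrr.
apply: preimage_closed => [g _|]; last exact: closed_eq.
by apply: continuousB; [exact: cF|exact: cG].
Qed.

Let closed_all (I : Type) (P : I -> set T) :
  (forall i, closed (P i)) -> closed [set g | forall i, P i g].
Proof.
move=> cP; have -> : [set g | forall i, P i g] = \bigcap_i P i.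
  by apply/seteqP; split=> g /= Pg i => [_|]; exact: Pg.
by apply: closed_bigI.
Qed.

Let closed_joinings : closed (joinings a b : set T).
Proof.
pose P1 := [set g : T | forall w w', 0 <= g w w'].
pose P2 := [set g : T | forall w w', g w w' = g w' w].
pose P3 := [set g : T | \sum_w marginal g w = 1].
pose P4 := [set g : T | forall u, \sum_v marginal g (u, v) = marginal a u].
pose P5 := [set g : T | forall v, \sum_u marginal g (u, v) = marginal b v].
pose P6 := [set g : T | forall u u' v,
  marginal a u * (\sum_v' g (u, v) (u', v')) = a u u' * marginal g (u, v)].
pose P7 := [set g : T | forall u v v',
  marginal b v * (\sum_u' g (u, v) (u', v')) = b v v' * marginal g (u, v)].
have -> : (joinings a b : set T) =
    P1 `&` P2 `&` P3 `&` P4 `&` P5 `&` P6 `&` P7.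
  by apply/seteqP; split=> [g [[? ? ?] ? ? ? ?]|g [[[[[[? ?] ?] ?] ?] ?] ?]];
    do ?split.
repeat apply: closedI.
- apply: closed_all => w; apply: closed_all => w'.
  apply: (@preimage_closed _ _ (fun g : T => g w w' : R^o) [set x | 0 <= x]).
    by move=> g _; exact: continuous_coord.
  exact: closed_ge.
- by apply: closed_all => w; apply: closed_all => w'; exact: closed_eqf.
- by apply: closed_eqf; [exact: continuous_sum|exact: cst_continuous].
- apply: closed_all => u.
  by apply: closed_eqf; [exact: continuous_sum|exact: cst_continuous].
- apply: closed_all => v.
  by apply: closed_eqf; [exact: continuous_sum|exact: cst_continuous].
- apply: closed_all => u; apply: closed_all => u'; apply: closed_all => v.
  by apply: closed_eqf; apply: continuous_scale => //; exact: continuous_sum.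
- apply: closed_all => u; apply: closed_all => v; apply: closed_all => v'.
  by apply: closed_eqf; apply: continuous_scale => //; exact: continuous_sum.
Qed.

Let compact_joinings : compact (joinings a b : set T).
Proof.
pose B := [set g : T | forall w w', `[0, 1]%classic (g w w' : R)].
apply: (@subclosed_compact _ _ B) => //.
  apply: (@tychonoff W (fun=> {ptws W -> R^o})
    (fun=> [set h | forall w', `[0, 1]%classic (h w' : R)])) => w.
  apply: (@tychonoff W (fun=> R^o) (fun=> `[0, 1]%classic)) => w'.
  exact: segment_compact.
move=> g [[g0 _ g1] _ _ _ _] w w' /=; rewrite in_itv /= g0 /= -g1.
rewrite (bigD1 w) //= (bigD1 w') //= -addrA lerDl addr_ge0 ?sumr_ge0 // => x _.
by rewrite sumr_ge0.
Qed.

Lemma ogj_distance_attained : is_weight a -> is_weight b ->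
  exists2 g, optimal_joinings a b c g & expected_cost c g = ogj_distance a b c.
Proof.
move=> wa wb.
have J0 : (joinings a b : set T) !=set0 by eexists; exact: prod_joining wa wb.
have cc : continuous (fun g : T => expected_cost c g).
  by do 2 apply: continuous_sum => ?; exact: continuous_scale.
have [g /set_mem Jg gmin] :=
  compact_EVT_min J0 compact_joinings (continuous_subspaceT cc).
have {}gmin h : joinings a b h -> expected_cost c g <= expected_cost c h.
  by move=> Jh; apply: gmin; exact/mem_set.
exists g; first by split.
apply/eqP; rewrite eq_le; apply/andP; split.
  apply: lb_le_inf; first by exists (expected_cost c g), g.
  by move=> _ [h Jh <-]; exact: gmin.
apply: ge_inf; last by exists g.
by exists (expected_cost c g) => _ [h Jh <-]; exact: gmin.
Qed.

End Attained.

Section Graphs.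
Variables (R : realType) (L : Type).

Record graph := Graph {
  vertex :> finType;
  weight : vertex -> vertex -> R;
  label : vertex -> L;
  weightP : is_weight weight
}.

Definition neighbors (G : graph) (u : G) : {set G} :=
  [set u' | 0 < weight u u'].

Definition connected_graph (G : graph) : Prop :=
  forall u u' : G, u != u' -> connect [rel x y | 0 < weight x y] u u'.

Definition graph_iso (G H : graph) (f : G -> H) : Prop :=
  [/\ bijective f,
      forall u u', weight u u' = weight (f u) (f u')
    & forall u, label u = label (f u)].

Definition isomorphic (G H : graph) : Prop :=
  exists f : G -> H, graph_iso f.

End Graphs.

Section Labelings.
Variables (R : realType) (L L' : Type) (F : graph R L -> Prop).

(* Labels are only given for members of [F].  The dependence on the membership
   proof is harmless: [iso_invariant], applied to the identity, removes it. *)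
Definition secondary_labeling := forall G : graph R L, F G -> G -> L'.

Variable phi' : secondary_labeling.

Definition aug_label (G : graph R L) (hG : F G) (u : G) : L * L' :=
  (label u, phi' hG u).

Definition iso_invariant : Prop :=
  forall (G H : graph R L) (hG : F G) (hH : F H) (f : G -> H),
    graph_iso f -> forall u, aug_label hH (f u) = aug_label hG u.

Definition locally_injective : Prop :=
  forall (G : graph R L) (hG : F G) (u : G),
    {in neighbors u &, injective (aug_label hG)}.

Definition magic_symbols : Prop :=
  forall (G : graph R L) (hG : F G),
    exists u : G, #|[set u' | `[< aug_label hG u' = aug_label hG u >]]%SET| = 1%N.

Definition label_cost (G H : graph R L) (hG : F G) (hH : F H)
    (u : G) (v : H) : R :=
  `[< aug_label hG u <> aug_label hH v >]%:R.

Definition detects_isomorphism : Prop :=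
  forall (G H : graph R L) (hG : F G) (hH : F H),
    ogj_distance (@weight R L G) (@weight R L H) (label_cost hG hH) = 0 <->
    isomorphic G H.

Definition identifies_isomorphism : Prop :=
  forall (G H : graph R L) (hG : F G) (hH : F H), isomorphic G H ->
    extreme_points
      (optimal_joinings (@weight R L G) (@weight R L H) (label_cost hG hH)) =
    [set g | [/\ joinings (@weight R L G) (@weight R L H) g,
                 bijective_joining g
               & expected_cost (label_cost hG hH) g = 0]].

End Labelings.

(* Main.v *)
(* A joining [g] of cost zero only charges pairs [(u, v)] with equal labels, and
   the transition conditions let edges be lifted: if [r_g(u, v) > 0] then every
   edge [u - u'] lifts to an edge [v - v'] with [r_g(u', v') > 0].  By local
   injectivity, two partners of [u] are equal as soon as their lifts along an
   edge [u - u'] are, so uniqueness of the partner propagates along paths.  It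
   holds at a partner of a magic vertex of the other graph, hence everywhere by
   connectedness.  So the support of [g] is the graph of an isomorphism [f] and
   [g] is the copy of the weight carried by the graph of [f]; in particular [g]
   is determined by its support, and a proper convex combination of two such
   joinings has a support containing both of theirs. *)
Require Import Defs.
From HB Require Import structures.
From mathcomp Require Import all_boot all_order all_algebra.
From mathcomp Require Import all_classical all_reals all_analysis.

Set Implicit Arguments.
Unset Strict Implicit.
Unset Printing Implicit Defensive.

Import Order.TTheory GRing.Theory Num.Theory.

Local Open Scope ring_scope.

(** * Positivity of finite sums *)

Section Sums.
Variables (R : realType) (I : finType) (f : I -> R).

Lemma sumr_gt0_exists : 0 < \sum_i f i -> exists i, 0 < f i.
Proof.
move=> s_gt0; have /existsP[i fi] : [exists i, 0 < f i]; last by exists i.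
apply: contraTT s_gt0; rewrite negb_exists => /forallP f_le0.
by rewrite -leNgt sumr_le0 // => i _; rewrite leNgt f_le0.
Qed.

Lemma sumr_gt0_term i : (forall j, 0 <= f j) -> 0 < f i -> 0 < \sum_i f i.
Proof.
by move=> f_ge0 fi; rewrite (bigD1 i) //= ltr_wpDr // sumr_ge0.
Qed.

End Sums.

(** The total weight is 1, so some vertex [w] has positive marginal; any other [u] starts a path to
    [w], and the first edge of that path contributes to the marginal of [u]. *)
Lemma connected_marginal_gt0 (R : realType) (U : finType) (a : U -> U -> R) :
  is_weight a ->
  (forall u u', u != u' -> connect [rel x y | 0 < a x y] u u') ->
  forall u, 0 < marginal a u.
Proof.
move=> [a_ge0 _ a1] con u.
have [|w w_gt0] := @sumr_gt0_exists _ _ (marginal a).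
  by rewrite [X in 0 < X]a1.
have [->//|/con/connectP[[|x p] /=]] := eqVneq u w; first by move=> _ <-.
by case/andP => /(sumr_gt0_term (a_ge0 u)).
Qed.

(** * Swapping, edge lifting and uniqueness of partners for weight joinings *)

Section Joinings.
Variables (R : realType) (U V : finType).
Variables (a : U -> U -> R) (b : V -> V -> R).

(** Carries every result about partners of vertices of [U] over to partners of vertices of [V]. *)
Lemma joinings_swap (g : U * V -> U * V -> R) : joinings a b g ->
  joinings b a (fun w w' => g (w.2, w.1) (w'.2, w'.1)) /\
  forall u v,
    marginal (fun w w' => g (w.2, w.1) (w'.2, w'.1)) (v, u) = marginal g (u, v).
Proof.
set h := fun _ _ => _.
have swap_bij : bijective (fun w : V * U => (w.2, w.1)).
  by exists (fun w => (w.2, w.1)); case.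
have mE u v : marginal h (v, u) = marginal g (u, v).
  rewrite /marginal [RHS](reindex (fun w : V * U => (w.2, w.1))) //=.
  exact: onW_bij.
move=> [[g_ge0 gC g1] gU gV ga gb]; split=> //; split.
- split=> [w w'|w w'|]; [exact: g_ge0|exact: gC|].
  rewrite -g1 [RHS](reindex (fun w : V * U => (w.2, w.1))) /=; last exact: onW_bij.
  by apply: eq_bigr => -[v u] _; exact: mE.
- by move=> v; rewrite -gV; apply: eq_bigr => u _; rewrite mE.
- by move=> u; rewrite -gU; apply: eq_bigr => v _; rewrite mE.
- by move=> v v' u; rewrite mE -gb.
- by move=> v u u'; rewrite mE -ga.
Qed.

Variable g : U * V -> U * V -> R.
Hypothesis gJ : joinings a b g.

Lemma joining_marginal_ge0 w : 0 <= marginal g w.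
Proof. by case: gJ => -[g_ge0 _ _] _ _ _ _; exact: sumr_ge0. Qed.

Lemma joining_gt0 w w' : 0 < g w w' -> 0 < marginal g w /\ 0 < marginal g w'.
Proof.
case: gJ => -[g_ge0 gC _] _ _ _ _ gt0; split.
  exact: sumr_gt0_term gt0.
by apply: (@sumr_gt0_term _ _ _ w) => //; rewrite gC.
Qed.

Lemma joining_partner u : 0 < marginal a u -> exists v, 0 < marginal g (u, v).
Proof.
by case: gJ => _ <- _ _ _; exact: sumr_gt0_exists.
Qed.

(** The transition condition over [a] gives [(u, v)] positive mass towards the fibre of [u'], hence
    towards some [(u', v')]; the condition over [b] then forces [b v v'] to be positive. *)
Lemma joining_lift u v u' :
  (forall u, 0 < marginal a u) -> (forall v, 0 < marginal b v) ->
  0 < marginal g (u, v) -> 0 < a u u' ->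
  exists2 v', 0 < b v v' & 0 < marginal g (u', v').
Proof.
case: gJ => -[g_ge0 gC _] _ _ ga gb a_gt0 b_gt0 guv auu'.
have [|v' gv'] := @sumr_gt0_exists _ _ (fun v' => g (u, v) (u', v')).
  by rewrite -(pmulr_rgt0 _ (a_gt0 u)) ga mulr_gt0.
exists v'; last by case: (joining_gt0 gv').
rewrite -(pmulr_lgt0 _ guv) -gb mulr_gt0 //.
by apply: (@sumr_gt0_term _ _ (fun u' => g (u, v) (u', v')) u').
Qed.

(** Induction on a path from [u] to some partner [u0] of the magic vertex [v0]. *)
Lemma joining_partner_unique (T : Type) (lU : U -> T) (lV : V -> T) (v0 : V) :
  is_weight b ->
  (forall u, 0 < marginal a u) -> (forall v, 0 < marginal b v) ->
  (forall u u', u != u' -> connect [rel x y | 0 < a x y] u u') ->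
  (forall v v1 v2, 0 < b v v1 -> 0 < b v v2 -> lV v1 = lV v2 -> v1 = v2) ->
  (forall v, lV v = lV v0 -> v = v0) ->
  (forall u v, 0 < marginal g (u, v) -> lU u = lV v) ->
  forall u v1 v2, 0 < marginal g (u, v1) -> 0 < marginal g (u, v2) -> v1 = v2.
Proof.
move=> [_ bC _] a_gt0 b_gt0 con inj magic lE u.
have [u0 gu0] : exists u0, 0 < marginal g (u0, v0).
  case: gJ => _ _ gV _ _.
  by apply: (@sumr_gt0_exists _ _ (fun u => marginal g (u, v0))); rewrite gV.
have : connect [rel x y | 0 < a x y] u u0.
  by have [->|/con//] := eqVneq u u0; exact: connect0.
case/connectP => p; elim: p u => [|u' p IH] u /=.
  (* Here [u] is [u0], so each of its partners carries the label of [v0] and is [v0] itself. *)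
  move=> _ u0E v1 v2 g1 g2.
  have gE v : 0 < marginal g (u, v) -> v = v0.
    by move=> gv; apply: magic; rewrite -(lE _ _ gv) -u0E (lE _ _ gu0).
  by rewrite (gE _ g1) (gE _ g2).
case/andP => auu' path_p u0E v1 v2 g1 g2.
have [w1 bw1 gw1] := joining_lift a_gt0 b_gt0 g1 auu'.
have [w2 bw2 gw2] := joining_lift a_gt0 b_gt0 g2 auu'.
have w21 := IH _ path_p u0E _ _ gw2 gw1.
(* The lifts [w1] and [w2] agree, so [v1] and [v2] are neighbours of the same vertex, and both carry
   the label of [u]. *)
apply: (inj w1); first by rewrite bC.
  by rewrite bC -w21.
by rewrite -(lE _ _ g1) (lE _ _ g2).
Qed.

(** With a single partner per vertex, [marginal g (u, v)] is all of [marginal a u], and the sum over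
    [v'] in the transition condition has one nonzero term; the factor [marginal a u] then
    cancels. *)
Lemma joining_on_support :
  (forall u, 0 < marginal a u) ->
  (forall u v1 v2, 0 < marginal g (u, v1) -> 0 < marginal g (u, v2) -> v1 = v2) ->
  forall u v u' v', 0 < marginal g (u, v) -> 0 < marginal g (u', v') ->
  g (u, v) (u', v') = a u u'.
Proof.
case: gJ => -[g_ge0 _ _] gU _ ga _ a_gt0 uniq u v u' v' guv gu'v'.
have gE : marginal g (u, v) = marginal a u.
  rewrite -gU (bigD1 v) //= big1 ?addr0 // => w w_v.
  apply/eqP; rewrite eq_le joining_marginal_ge0 andbT leNgt.
  by apply: contraNN w_v => /uniq/(_ guv) ->.
apply: (@mulfI _ (marginal a u)); first by rewrite gt_eqF.
rewrite [RHS]mulrC -{2}gE -ga; congr (_ * _).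
rewrite (bigD1 v') //= big1 ?addr0 // => w w_v'.
apply/eqP; rewrite eq_le g_ge0 andbT leNgt.
by apply: contraNN w_v' => /joining_gt0[_ /uniq/(_ gu'v') ->].
Qed.

End Joinings.

(** * Joinings of cost zero between labelled graphs *)

Section GraphJoinings.
Variables (R : realType) (L L' : Type) (F : graph R L -> Prop).
Variable phi' : secondary_labeling L' F.
Hypothesis F_connected : forall G, F G -> connected_graph G.

Lemma graph_marginal_gt0 (G : graph R L) : F G ->
  forall u : G, 0 < marginal (@weight R L G) u.
Proof.
by move=> /F_connected; apply: connected_marginal_gt0; exact: weightP.
Qed.

Section Pair.
Variables (G H : graph R L) (hG : F G) (hH : F H).
Local Notation J := (joinings (@weight R L G) (@weight R L H)).
Local Notation cost := (expected_cost (label_cost phi' hG hH)).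

Lemma expected_label_cost_ge0 g : J g -> 0 <= cost g.
Proof.
move=> gJ; apply: sumr_ge0 => u _; apply: sumr_ge0 => v _.
by rewrite mulr_ge0 ?ler0n // (joining_marginal_ge0 gJ).
Qed.

Lemma cost0_label_eq g : J g -> cost g = 0 ->
  forall u v, 0 < marginal g (u, v) ->
  aug_label phi' hG u = aug_label phi' hH v.
Proof.
move=> gJ g0 u v guv; apply: contrapT => neq.
have term_ge0 x y : 0 <= label_cost phi' hG hH x y * marginal g (x, y).
  by rewrite mulr_ge0 ?ler0n // (joining_marginal_ge0 gJ).
suff: 0 < cost g by rewrite g0 ltxx.
apply: (@sumr_gt0_term _ _ _ u) => [x|]; first exact: sumr_ge0.
apply: (@sumr_gt0_term _ _ _ v) => //.
by rewrite /label_cost asboolT // mul1r.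
Qed.

Lemma label_eq_cost0 g : J g ->
  (forall u v, 0 < marginal g (u, v) ->
    aug_label phi' hG u = aug_label phi' hH v) ->
  cost g = 0.
Proof.
move=> gJ lE; apply: big1 => u _; apply: big1 => v _.
have := joining_marginal_ge0 gJ (u, v); rewrite le_eqVlt => /predU1P[<-|guv].
  by rewrite mulr0.
by rewrite /label_cost asboolF ?mul0r // => /(_ (lE _ _ guv)).
Qed.

(** The magic vertex is taken in [H]; uniqueness in the other direction uses one in [G], through the
    swapped joining. *)
Lemma cost0_partner_unique g :
  locally_injective phi' -> magic_symbols phi' -> J g -> cost g = 0 ->
  forall u v1 v2, 0 < marginal g (u, v1) -> 0 < marginal g (u, v2) -> v1 = v2.
Proof.
move=> linj magic gJ g0; have [v0 v0_card] := magic _ hH.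
apply: (joining_partner_unique gJ (v0 := v0) (lV := aug_label phi' hH)).
- exact: weightP.
- exact: graph_marginal_gt0.
- exact: graph_marginal_gt0.
- exact: F_connected.
- move=> v v1 v2 vv1 vv2; apply: (linj H hH v); by rewrite inE.
- move=> v lv; have /eqP/cards1P[x xE] := v0_card.
  have : v \in [set x] by rewrite -xE inE; apply/asboolP.
  have : v0 \in [set x] by rewrite -xE inE; apply/asboolP.
  by rewrite !inE => /eqP -> /eqP.
- exact: cost0_label_eq.
Qed.

End Pair.

Lemma expected_label_cost_swap (G H : graph R L) (hG : F G) (hH : F H) g :
  joinings (@weight R L G) (@weight R L H) g ->
  expected_cost (label_cost phi' hH hG)
    (fun w w' => g (w.2, w.1) (w'.2, w'.1)) =
  expected_cost (label_cost phi' hG hH) g.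
Proof.
move=> /joinings_swap[_ mE]; rewrite /expected_cost exchange_big /=.
apply: eq_bigr => u _; apply: eq_bigr => v _; rewrite mE; congr (_%:R * _).
by congr nat_of_bool; apply: asbool_equiv_eq; split=> ne /esym.
Qed.

Hypothesis linj : locally_injective phi'.
Hypothesis magic : magic_symbols phi'.

Section Pair.
Variables (G H : graph R L) (hG : F G) (hH : F H).
Local Notation J := (joinings (@weight R L G) (@weight R L H)).
Local Notation cost := (expected_cost (label_cost phi' hG hH)).

Lemma cost0_bijective_joining g : J g -> cost g = 0 -> bijective_joining g.
Proof.
move=> gJ g0; split=> [u|v].
  have [v gv] := joining_partner gJ (graph_marginal_gt0 hG u).
  exists v; split=> // v'; exact: (cost0_partner_unique linj magic gJ g0) gv.
have [gJ' mE] := joinings_swap gJ.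
have [u] := joining_partner gJ' (graph_marginal_gt0 hH v).
rewrite mE => gu; exists u; split=> // u' gu'.
apply: (cost0_partner_unique (hG := hH) (hH := hG) linj magic gJ' _ (u := v)).
- by rewrite expected_label_cost_swap.
- by rewrite mE.
- by rewrite mE.
Qed.

Lemma cost0_weight g : J g -> cost g = 0 ->
  forall u v u' v', 0 < marginal g (u, v) -> 0 < marginal g (u', v') ->
  g (u, v) (u', v') = weight u u'.
Proof.
move=> gJ g0; apply: (joining_on_support gJ); first exact: graph_marginal_gt0.
exact: cost0_partner_unique.
Qed.

Lemma cost0_isomorphic g : J g -> cost g = 0 -> isomorphic G H.
Proof.
move=> gJ g0; have [gG gH] := cost0_bijective_joining gJ g0.
have [f fP] := choice gG; have [f' f'P] := choice gH.
have fS u : 0 < marginal g (u, f u) by have [] := fP u.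
exists f; split.
- exists f' => [u|v].
    by have [_] := f'P (f u); apply.
  by have [_] := fP (f' v); apply; have [] := f'P v.
(* On its support [g] equals the weight of [G], and its swap equals the weight of [H]; comparing the
   two shows that [f] preserves weights. *)
- move=> u u'; rewrite -(cost0_weight gJ g0 (fS u) (fS u')).
  have [gJ' mE] := joinings_swap gJ.
  rewrite -(joining_on_support gJ' _ _ (v := u) (v' := u')) ?mE //.
    exact: graph_marginal_gt0.
  apply: (cost0_partner_unique (hG := hH) (hH := hG) linj magic gJ').
  by rewrite expected_label_cost_swap.
- by move=> u; have [] := cost0_label_eq gJ g0 (fS u).
Qed.

(* The nested supports are both graphs of functions on [G], hence equal. *)
Lemma cost0_joining_eq g h : J g -> cost g = 0 -> J h -> cost h = 0 ->
  (forall w, 0 < marginal h w -> 0 < marginal g w) -> h = g.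
Proof.
move=> gJ g0 hJ h0 sub; have gsub u v : 0 < marginal g (u, v) -> 0 < marginal h (u, v).
  move=> guv; have [v' hv'] := joining_partner hJ (graph_marginal_gt0 hG u).
  by rewrite (cost0_partner_unique linj magic gJ g0 guv (sub _ hv')).
apply/funext => -[u v]; apply/funext => -[u' v'].
(* A joining vanishes at any pair with an endpoint outside its support, so only the values on the
   common support remain to be compared. *)
have off k : J k -> ~ (0 < marginal k (u, v) /\ 0 < marginal k (u', v')) ->
    k (u, v) (u', v') = 0.
  move=> kJ nk; apply/eqP; rewrite eq_le; have [[k_ge0 _ _] _ _ _ _] := kJ.
  by rewrite k_ge0 andbT leNgt; apply/negP => /(joining_gt0 kJ).
have [[huv huv']|nh] := pselect (0 < marginal h (u, v) /\ 0 < marginal h (u', v')).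
  by rewrite (cost0_weight hJ h0) // (cost0_weight gJ g0) //; exact: sub.
by rewrite !off // => -[g1 g2]; apply: nh; split; exact: gsub.
Qed.

End Pair.

(** * The joining of cost zero carried by an isomorphism *)

Section Isomorphism.
Variables (G H : graph R L) (f : G -> H).
Hypothesis f_iso : graph_iso f.

(** The pushforward of the weight of [G] under [u |-> (u, f u)], with the indicators as left factors
    so that [sum_delta] evaluates its sums. *)
Definition graph_joining (w w' : G * H) : R :=
  (f w.1 == w.2)%:R * ((f w'.1 == w'.2)%:R * weight w.1 w'.1).

Let sum_delta (u : G) (c : R) : \sum_(v : H) (f u == v)%:R * c = c.
Proof.
rewrite (bigD1 (f u)) //= eqxx mul1r big1 ?addr0 // => v.
by rewrite eq_sym => /negbTE ->; rewrite mul0r.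
Qed.

Lemma marginal_graph_joining u v :
  marginal graph_joining (u, v) = (f u == v)%:R * marginal (@weight R L G) u.
Proof.
rewrite /marginal /graph_joining -mulr_sumr; congr (_ * _).
rewrite -(pair_bigA _ (fun u' v' => (f u' == v')%:R * weight u u')) /=.
by apply: eq_bigr => u' _; exact: sum_delta.
Qed.

Lemma graph_joining_joinings :
  joinings (@weight R L G) (@weight R L H) graph_joining.
Proof.
have [[f' fK f'K] fw _] := f_iso; have [a_ge0 aC a1] := weightP G.
have sum_delta' v (c : G -> R) : \sum_u (f u == v)%:R * c u = c (f' v).
  rewrite (bigD1 (f' v)) //= f'K eqxx mul1r big1 ?addr0 // => u.
  by rewrite -(can_eq f'K) fK => /negbTE; rewrite -(can_eq fK) f'K => ->; rewrite mul0r.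
have marginal_f v : marginal (@weight R L G) (f' v) = marginal (@weight R L H) v.
  rewrite /marginal [RHS](reindex f) /=; last by apply: onW_bij; exists f'.
  by apply: eq_bigr => u _; rewrite fw f'K.
split.
- split=> [w w'|w w'|].
  + by rewrite !mulr_ge0 ?ler0n.
  + by rewrite /graph_joining mulrCA aC.
  + rewrite -[RHS]a1.
    transitivity (\sum_u \sum_v marginal graph_joining (u, v)).
      by rewrite [RHS]pair_bigA; apply: eq_bigr => -[].
    apply: eq_bigr => u _; rewrite -[RHS](sum_delta u).
    by apply: eq_bigr => v _; exact: marginal_graph_joining.
- move=> u; rewrite -[RHS](sum_delta u).
  by apply: eq_bigr => v _; exact: marginal_graph_joining.
- move=> v; under eq_bigr do rewrite marginal_graph_joining.
  by rewrite sum_delta' marginal_f.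
- move=> u u' v; rewrite marginal_graph_joining /graph_joining /= -mulr_sumr.
  by rewrite sum_delta mulrCA [RHS]mulrCA [marginal _ _ * _]mulrC.
- move=> u v v'; rewrite marginal_graph_joining /graph_joining /= -mulr_sumr.
  (* Both sides vanish off the graph of [f]; on it the condition says that [f] preserves weights and
     marginals. *)
  rewrite sum_delta'; have [<-|] := eqVneq (f u) v; last by rewrite !mul0r !mulr0.
  by rewrite -marginal_f fK fw f'K !mul1r mulrC.
Qed.

Lemma graph_joining_cost (hG : F G) (hH : F H) : iso_invariant phi' ->
  expected_cost (label_cost phi' hG hH) graph_joining = 0.
Proof.
move=> inv; apply: (label_eq_cost0 graph_joining_joinings) => u v.
rewrite marginal_graph_joining; have [<- _|] := eqVneq (f u) v.
  by rewrite (inv _ _ hG hH f f_iso).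
by rewrite mul0r ltxx.
Qed.

End Isomorphism.

(** Costs are nonnegative and [graph_joining] costs zero, so the minimum is zero. *)
Lemma optimal_joiningsE (G H : graph R L) (hG : F G) (hH : F H) :
  iso_invariant phi' -> isomorphic G H ->
  optimal_joinings (@weight R L G) (@weight R L H) (label_cost phi' hG hH) =
  [set g | joinings (@weight R L G) (@weight R L H) g /\
    expected_cost (label_cost phi' hG hH) g = 0]%classic.
Proof.
move=> inv [f f_iso]; apply/seteqP; split=> g [gJ g_min]; split=> //.
  apply/eqP; rewrite eq_le expected_label_cost_ge0 // andbT.
  rewrite -(graph_joining_cost f_iso hG hH inv).
  exact: g_min (graph_joining_joinings f_iso).
by move=> h hJ; rewrite g_min expected_label_cost_ge0.
Qed.

End GraphJoinings.

Theorem theorem4p3 (R : realType) (L L' : Type) (F : graph R L -> Prop)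
    (phi' : secondary_labeling L' F) :
  (forall G, F G -> connected_graph G) ->
  iso_invariant phi' ->
  locally_injective phi' ->
  magic_symbols phi' ->
  detects_isomorphism phi' /\ identifies_isomorphism phi'.
Proof.
move=> con inv linj magic; split=> [G H hG hH|G H hG hH iso].
  (* Since the infimum is attained, a zero distance yields an actual joining of cost zero. *)
  have [g gopt <-] := ogj_distance_attained (label_cost phi' hG hH) (weightP G) (weightP H).
  split=> [g0|iso].
    by have [gJ _] := gopt; exact: (cost0_isomorphic con linj magic gJ g0).
  by move: gopt; rewrite optimal_joiningsE // => -[].
rewrite optimal_joiningsE //; apply/seteqP; split=> g.
  by move=> [[gJ g0] _]; split=> //; exact: (cost0_bijective_joining con linj magic gJ g0).
move=> [gJ _ g0]; split=> // y z t [yJ y0] [zJ z0] /andP[t0 t1] gE.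
(* Marginals are linear in the joining and both coefficients are positive, so the supports of [y]
   and [z] lie inside that of [g], as [cost0_joining_eq] requires. *)
have mE w : marginal g w = t * marginal y w + (1 - t) * marginal z w.
  rewrite /marginal !mulr_sumr -big_split; apply: eq_bigr => w' _.
  by rewrite gE.
have t1' : 0 < 1 - t by rewrite subr_gt0.
split; apply: (cost0_joining_eq con linj magic gJ g0) => // w w_gt0; rewrite mE.
  apply: ltr_wpDr; first by rewrite mulr_ge0 ?(ltW t1') // (joining_marginal_ge0 zJ).
  by rewrite mulr_gt0.
apply: ltr_wpDl; first by rewrite mulr_ge0 ?(ltW t0) // (joining_marginal_ge0 yJ).
by rewrite mulr_gt0.
Qed.
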